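(* Let $X$ be a finite $2$-distance space with non-zero distances $a$ and $b$, $a<b$, and let $n=\#X$. Let $G$ be the graph with vertex set $X$ whose edges are exactly the pairs of points of $X$ at distance $a$ from each other, and let $\theta(G)$ be the clique covering number of $G$. Let $m$ be a positive integer. Then $X$ cannot be partitioned into $m$ subsets of strictly smaller diameters if $m<\theta(G)$, and $X$ can be partitioned into $m$ subsets of strictly smaller diameters if $\theta(G)\le m\le n$.
   Context: $\#X$ denotes the cardinality of $X$. A finite $2$-distance space with non-zero distances $a<b$ is a finite metric space in which the distances between distinct points take exactly the two values $a$ and $b$ (both occur, $0<a<b$); in particular $\operatorname{diam}X=b$. ''Partitioned into $m$ subsets of strictly smaller diameters'' means: there is a partition of $X$ into exactly $m$ non-empty subsets each of which has diameter strictly less than $\operatorname{diam}X$. A clique in a simple graph $H$ is a vertex subset any two distinct elements of which are adjacent (single vertices are cliques). The clique covering number $\theta(H)$ is the minimal number of cliques covering all vertices of $H$ (equivalently, the least number of cliques whose vertex sets partition the vertex set of $H$). *)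

(* Defs.v *)
From HB Require Import structures.
From mathcomp Require Import all_boot all_order all_algebra.
From mathcomp Require Import boolp classical_sets reals topology.

Set Implicit Arguments.
Unset Strict Implicit.
Unset Printing Implicit Defensive.

Import Order.TTheory GRing.Theory Num.Theory.

Local Open Scope ring_scope.

#[short(type="finMetricType")]
HB.structure Definition FinMetric (K : numDomainType) :=
  {T of Finite T & Metric K T}.

(* Subsets are finite sets [{set X}], and [partition] is the one of [finset]
   (nonempty disjoint blocks), not its homonym of [classical_sets]. *)

Section Metric.
Variables (R : realType) (X : finMetricType R).

Definition diam (A : {set X}) : R :=
  sup [set mdist x y | x in [set` A] & y in [set` A]]%classic.

Definition two_distance_space (a b : R) : Prop :=
  [/\ 0 < a < b,
      forall x y : X, x != y -> mdist x y = a \/ mdist x y = b,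
      exists x y : X, mdist x y = a
    & exists x y : X, mdist x y = b].

Definition smaller_diam_partition (m : nat) : Prop :=
  exists P : {set {set X}},
    [/\ finset.partition P [set: X], #|P| = m
      & forall A, A \in P -> diam A < diam [set: X]].

Definition dist_graph (a : R) : rel X := fun x y => mdist x y == a.

Lemma dist_graph_sym a : symmetric (dist_graph a).
Proof. by move=> x y; rewrite /dist_graph metric_sym. Qed.

Lemma dist_graph_irr a : 0 < a -> irreflexive (dist_graph a).
Proof. by move=> a0 x; rewrite /dist_graph mdistxx lt_eqF. Qed.

End Metric.

Arguments two_distance_space {R} X a b.
Arguments smaller_diam_partition {R} X m.
Arguments dist_graph {R} X a.

Section Graph.
Variables (V : finType) (e : rel V).

Definition clique (K : {set V}) : bool :=
  [forall x in K, forall y in K, (x != y) ==> e x y].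

Definition clique_cover (C : {set {set V}}) : bool :=
  [forall K in C, clique K] && (finset.cover C == [set: V]).

Definition clique_coverable (k : nat) : bool :=
  [exists C : {set {set V}}, clique_cover C && (#|C| == k)].

Lemma clique_coverable_exists : exists k, clique_coverable k.
Proof.
pose C := [set [set x] | x : V]%SET.
exists #|C|; apply/existsP; exists C; rewrite eqxx andbT; apply/andP; split.
  apply/forall_inP => K /imsetP[z _ ->].
  apply/forall_inP => x /set1P ->; apply/forall_inP => y /set1P ->.
  by rewrite eqxx.
apply/eqP/setP => x; rewrite inE; apply/bigcupP.
by exists [set x]; rewrite ?imset_f ?inE.
Qed.

Definition clique_covering_number : nat := ex_minn clique_coverable_exists.

End Graph.

(* Main.v *)
Require Import Defs.
From mathcomp Require Import all_boot all_order all_algebra.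
From mathcomp Require Import boolp classical_sets reals topology.

(** Since every non-zero distance is [a] or [b], a set has diameter less than
    [b = diam X] exactly when all its distinct points are at distance [a], that
    is, when it is a clique of the graph [G] ([diam_lt_clique]).  Partitions into
    sets of smaller diameter are thus the same as partitions into cliques.  Such
    a partition is a clique cover, so it has at least [theta(G)] blocks.

    For the converse, [clique_cover_partition] turns a clique cover [C] into a
    clique partition with any prescribed number [m] of blocks between [#|C|] and
    the number of vertices.  Choose a clique of [C] through each vertex, and one
    vertex to represent each chosen clique; extend the set of representatives to
    a set [S] of [m] vertices.  The retraction onto [S] that sends a vertex
    outside [S] to the representative of its clique has exactly [m] fibres, and
    each lies within a clique. *)

Set Implicit Arguments.
Unset Strict Implicit.
Unset Printing Implicit Defensive.

Import Order.TTheory GRing.Theory Num.Theory.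

Local Open Scope ring_scope.

Section FiniteSets.
Variable T : finType.

Lemma card_preim_partition (U : finType) (f : T -> U) (D : {set T}) :
  #|finset.preim_partition f D| = #|f @: D|.
Proof.
pose fibre u := [set y in D | u == f y]%SET.
have -> : finset.preim_partition f D = fibre @: (f @: D).
  by rewrite -imset_comp.
apply: card_in_imset => _ _ /imsetP[x Dx ->] /imsetP[y Dy ->] /setP/(_ x).
by rewrite !inE Dx eqxx /= => /esym/eqP.
Qed.

Lemma subset_extend_card (A : {set T}) m :
  (#|A| <= m <= #|T|)%N -> exists2 B : {set T}, A \subset B & #|B| = m.
Proof.
elim: m => [|m IHm] /andP[Am mT].
  by exists A => //; apply/eqP; rewrite -leqn0.
move: Am; rewrite leq_eqVlt => /predU1P[<-|Am]; first by exists A.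
have [|B sAB cardB] := IHm; first by rewrite -ltnS Am ltnW.
have [x xB] : exists x, x \notin B.
  apply/existsP; rewrite -negb_forall; apply: contraL mT => /forallP allB.
  rewrite -leqNgt -cardB; apply/subset_leq_card/fintype.subsetP => x _.
  exact: allB.
exists (x |: B)%SET; last by rewrite cardsU1 xB cardB.
by apply: fintype.subset_trans sAB _; rewrite finset.subsetU1.
Qed.

End FiniteSets.

Section Cliques.
Variables (V : finType) (e : rel V).

Lemma cliqueP (K : {set V}) :
  reflect {in K &, forall x y, x != y -> e x y} (clique e K).
Proof.
apply: (iffP forall_inP) => [cK x y xK yK xy | cK x xK].
  by move/(_ x xK)/forall_inP/(_ y yK)/implyP: cK; apply.
by apply/forall_inP => y yK; apply/implyP; apply: cK.
Qed.

Lemma clique_covering_number_le (C : {set {set V}}) :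
  clique_cover e C -> (clique_covering_number e <= #|C|)%N.
Proof.
move=> coverC; rewrite /clique_covering_number; case: ex_minnP => k _; apply.
by apply/existsP; exists C; rewrite coverC eqxx.
Qed.

Lemma clique_covering_number_attained :
  exists2 C : {set {set V}},
    clique_cover e C & #|C| = clique_covering_number e.
Proof.
rewrite /clique_covering_number; case: ex_minnP => k + _.
by case/existsP=> C /andP[coverC /eqP cardC]; exists C.
Qed.

(** The blocks are the fibres of a retraction onto a set of [m] vertices that
    contains one representative of each clique in use; enlarging this set is
    what provides every [m] from [#|C|] up to [#|V|] at once. *)
Lemma clique_cover_partition (C : {set {set V}}) m :
    clique_cover e C -> (#|C| <= m <= #|V|)%N ->
  exists P : {set {set V}},
    [/\ finset.partition P [set: V]%SET, #|P| = m
      & forall A, A \in P -> clique e A].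
Proof.
move=> /andP[/forall_inP cliqueC /eqP coverC] /andP[Cm mV].
pose f x := odflt finset.set0 [pick K in C | x \in K].
have fP x : f x \in C /\ x \in f x.
  rewrite /f; case: pickP => [K /andP[]//|noK].
  have /bigcupP[K CK xK] : x \in finset.cover C by rewrite coverC finset.in_setT.
  by have := noK K; rewrite CK xK.
pose r x := odflt x [pick y | f y == f x].
have f_r x : f (r x) = f x.
  by rewrite /r; case: pickP => [y /eqP|/(_ x)] //=; rewrite eqxx.
have r_f x y : f x = f y -> r x = r y.
  rewrite /r => fxy; rewrite -fxy; by case: pickP => // /(_ x); rewrite eqxx.
pose reps := (r @: [set: V])%SET.
have card_reps : (#|reps| <= #|C|)%N.
  rewrite -(card_in_imset (f := f)) => [|_ _ /imsetP[x _ ->] /imsetP[y _ ->]].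
    by apply/subset_leq_card/fintype.subsetP => _ /imsetP[x _ ->]; case: (fP x).
  by rewrite !f_r => /r_f.
have [|S sub_repsS cardS] := @subset_extend_card _ reps m.
  by rewrite mV (leq_trans card_reps).
pose g x := if x \in S then x else r x.
have f_g x : f (g x) = f x by rewrite /g; case: ifP => // _; apply: f_r.
have im_g : (g @: [set: V])%SET = S.
  apply/setP => y; apply/imsetP/idP => [[x _ ->]|yS]; last first.
    by exists y; rewrite ?finset.in_setT // /g yS.
  rewrite /g; case: ifP => // _.
  by apply: (fintype.subsetP sub_repsS); rewrite imset_f ?finset.in_setT.
exists (finset.preim_partition g [set: V]%SET); split.
- exact: preim_partitionP.
- by rewrite card_preim_partition im_g.
move=> _ /imsetP[z _ ->]; apply/cliqueP => x y; rewrite !inE /=.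
move=> /eqP zx /eqP zy.
have in_fz w : g z = g w -> w \in f z.
  by move=> zw; rewrite -(f_g z) zw f_g; case: (fP w).
by have /cliqueP := cliqueC _ (fP z).1; apply; apply: in_fz.
Qed.

End Cliques.

Section Diameter.
Variables (R : realType) (X : finMetricType R).
Implicit Types A : {set X}.

(** The supremum defining [diam A] is proper: the largest of the finitely many
    distances of [X] bounds it. *)
Lemma mdist_le_diam A x y : x \in A -> y \in A -> mdist x y <= diam A.
Proof.
move=> xA yA; apply: ub_le_sup; last by exists x => //; exists y.
exists (\big[Num.max/0]_(p : X * X) mdist p.1 p.2) => _ [u _] [v _] <-.
exact: (le_bigmax _ (fun p : X * X => mdist p.1 p.2) (u, v)).
Qed.

Lemma diam_le A (c : R) :
  0 <= c -> {in A &, forall x y, mdist x y <= c} -> diam A <= c.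
Proof.
move=> c0 Ac; have [->|[x xA]] := set_0Vmem A.
  (* the supremum of the empty set is [0] *)
  suff -> : diam (finset.set0 : {set X}) = 0 by [].
  rewrite /diam -[RHS](@sup0 R); congr (sup _).
  by apply/seteqP; split=> // d [u]; rewrite /= inE.
apply: ge_sup; first by exists (mdist x x); exists x => //; exists x.
by move=> _ [u uA] [v vA] <-; apply: Ac.
Qed.

Variables a b : R.
Hypothesis X_ab : two_distance_space X a b.

Lemma two_distance_diam : diam [set: X]%SET = b.
Proof.
have [/andP[a0 ab] dist_ab _ [x [y xyb]]] := X_ab.
apply/eqP; rewrite eq_le -{2}xyb mdist_le_diam ?finset.in_setT // andbT.
have b0 : 0 <= b by rewrite ltW // (lt_trans a0).
apply: diam_le => // u v _ _; have [->|/dist_ab[]->//] := eqVneq u v.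
  by rewrite mdistxx.
exact: ltW.
Qed.

Lemma diam_lt_clique A : (diam A < b) = clique (dist_graph X a) A.
Proof.
have [/andP[a0 ab] dist_ab _ _] := X_ab.
apply/idP/cliqueP => [Ab x y xA yA /dist_ab[/eqP//|xyb]|cA].
  by have := le_lt_trans (mdist_le_diam xA yA) Ab; rewrite xyb ltxx.
apply: le_lt_trans ab; apply: diam_le => [|x y xA yA]; first exact: ltW.
have [->|/(cA x y xA yA)/eqP->//] := eqVneq x y.
by rewrite mdistxx ltW.
Qed.

End Diameter.

Theorem corollary2p13 (R : realType) (X : finMetricType R) (a b : R)
    (hX : two_distance_space X a b) (m : nat) (hm : (0 < m)%N) :
  ((m < clique_covering_number (dist_graph X a))%N ->
     ~ smaller_diam_partition X m) /\
  ((clique_covering_number (dist_graph X a) <= m <= #|X|)%N ->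
     smaller_diam_partition X m).
Proof.
split=> [m_lt [P [partP cardP smallP]]|m_in].
  move: m_lt; rewrite ltnNge -cardP clique_covering_number_le //.
  apply/andP; split; last by case/and3P: partP.
  apply/forall_inP => A /smallP.
  by rewrite (two_distance_diam hX) (diam_lt_clique hX).
have [C coverC cardC] := clique_covering_number_attained (dist_graph X a).
have [|P [partP cardP cliquesP]] := clique_cover_partition (m := m) coverC.
  by rewrite cardC.
exists P; split=> // A /cliquesP.
by rewrite (two_distance_diam hX) (diam_lt_clique hX).
Qed.
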